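(* For $n\ge0$, the coefficient $c(\rho^{(6)};n)$ is odd if and only if $n=k(k+1)$ for some integer $k\ge0$. Moreover, for every integer $N\ge0$, $$\#\{0\le n\le N:\ c(\rho^{(6)};n)\equiv1\pmod2\}=\left\lfloor\frac{\sqrt{4N+1}+1}{2}\right\rfloor.$$
   Context: $(a;q)_n=\prod_{k=0}^{n-1}(1-aq^k)$. For a formal power series $g(q)=\sum_{n\ge0}c(n)q^n$, $c(g;n):=c(n)$. The sixth order mock theta function is $$\rho^{(6)}(q)=\sum_{n=0}^\infty\frac{q^{n(n+1)/2}(-q;q)_n}{(q;q^2)_{n+1}}.$$ *)

(* Defs.v *)
From HB Require Import structures.
From mathcomp Require Import all_boot all_order all_algebra.
From mathcomp Require Import boolp classical_sets reals.

Set Implicit Arguments.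
Unset Strict Implicit.
Unset Printing Implicit Defensive.

Import Order.TTheory GRing.Theory Num.Theory.

Local Open Scope ring_scope.

(* Formal power series in one variable; [fpscoef f n] is the coefficient of
   the n-th power of the variable.  A record rather than the bare type
   [nat -> R], which already carries the pointwise ring structure. *)
Record fps (R : Type) := Fps { fpscoef : nat -> R }.

Lemma fpsP (R : Type) (f g : fps R) :
  (forall n, fpscoef f n = fpscoef g n) -> f = g.
Proof. by case: f g => [f] [g] /= /funext ->. Qed.

HB.instance Definition _ (R : Type) := gen_eqMixin (fps R).
HB.instance Definition _ (R : Type) := gen_choiceMixin (fps R).

Section FpsRing.
Variable R : comNzRingType.
Implicit Types f g h : fps R.

Definition fps_zero : fps R := Fps (fun=> 0).
Definition fps_opp f : fps R := Fps (fun n => - fpscoef f n).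
Definition fps_add f g : fps R := Fps (fun n => fpscoef f n + fpscoef g n).

Fact fps_addA : associative fps_add.
Proof. by move=> f g h; apply: fpsP => n /=; rewrite addrA. Qed.
Fact fps_addC : commutative fps_add.
Proof. by move=> f g; apply: fpsP => n /=; rewrite addrC. Qed.
Fact fps_add0 : left_id fps_zero fps_add.
Proof. by move=> f; apply: fpsP => n /=; rewrite add0r. Qed.
Fact fps_addN : left_inverse fps_zero fps_opp fps_add.
Proof. by move=> f; apply: fpsP => n /=; rewrite addNr. Qed.

HB.instance Definition _ :=
  GRing.isZmodule.Build (fps R) fps_addA fps_addC fps_add0 fps_addN.

Definition fps_one : fps R := Fps (fun n => (n == 0%N)%:R).
Definition fps_mul f g : fps R :=
  Fps (fun n => \sum_(i < n.+1) fpscoef f i * fpscoef g (n - i)%N).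

Let trunc N f : {poly R} := \poly_(i < N.+1) fpscoef f i.

Let coef_truncM N f g n : (n <= N)%N ->
  (trunc N f * trunc N g)`_n = fpscoef (fps_mul f g) n.
Proof.
move=> leN; rewrite coefM /=; apply: eq_bigr => i _.
have leiN : (i <= N)%N by apply: leq_trans leN; rewrite -ltnS.
by rewrite !coef_poly !ltnS leiN (leq_trans (leq_subr _ _) leN).
Qed.

Fact fps_mulC : commutative fps_mul.
Proof.
by move=> f g; apply: fpsP => n; rewrite -!(@coef_truncM n) // mulrC.
Qed.

Let coef_truncM3 f g h n :
  fpscoef (fps_mul f (fps_mul g h)) n
  = (trunc n f * (trunc n g * trunc n h))`_n.
Proof.
rewrite coefM /=; apply: eq_bigr => i _.
by rewrite coef_poly ltn_ord (@coef_truncM n) ?leq_subr.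
Qed.

Fact fps_mulA : associative fps_mul.
Proof.
move=> f g h; apply: fpsP => n.
rewrite [in RHS]fps_mulC !coef_truncM3.
by rewrite [in RHS]mulrC mulrA.
Qed.

Fact fps_mul1 : left_id fps_one fps_mul.
Proof.
move=> f; apply: fpsP => n /=.
by rewrite big_ord_recl big1 ?mul1r ?subn0 ?addr0 // => i _; rewrite mul0r.
Qed.

Fact fps_mulDl : left_distributive fps_mul fps_add.
Proof.
move=> f g h; apply: fpsP => n /=.
by rewrite -big_split; apply: eq_bigr => i _; rewrite mulrDl.
Qed.

Fact fps_one_neq0 : fps_one != fps_zero.
Proof.
apply/eqP => /(congr1 (fun f => fpscoef f 0%N)) /= /eqP.
by rewrite oner_eq0.
Qed.

HB.instance Definition _ := GRing.Zmodule_isComNzRing.Build (fps R)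
  fps_mulA fps_mulC fps_mul1 fps_mulDl fps_one_neq0.

Lemma fpscoef0 n : fpscoef (0 : fps R) n = 0. Proof. by []. Qed.

Lemma fpscoef1 n : fpscoef (1 : fps R) n = (n == 0%N)%:R. Proof. by []. Qed.

Lemma fpscoefN f n : fpscoef (- f) n = - fpscoef f n. Proof. by []. Qed.

Lemma fpscoefD f g n : fpscoef (f + g) n = fpscoef f n + fpscoef g n.
Proof. by []. Qed.

Lemma fpscoefM f g n :
  fpscoef (f * g) n = \sum_(i < n.+1) fpscoef f i * fpscoef g (n - i)%N.
Proof. by []. Qed.

Lemma fpscoef_sum I (r : seq I) (P : pred I) (F : I -> fps R) n :
  fpscoef (\sum_(i <- r | P i) F i) n = \sum_(i <- r | P i) fpscoef (F i) n.
Proof. by apply: (big_morph (fun f => fpscoef f n)). Qed.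

Definition fpsX : fps R := Fps (fun n => (n == 1%N)%:R).

Lemma fpscoefXM f n :
  fpscoef (fpsX * f) n = if n is m.+1 then fpscoef f m else 0.
Proof.
rewrite fpscoefM; case: n => [|n]; first by rewrite big_ord1 mul0r.
rewrite big_ord_recl mul0r add0r big_ord_recl mul1r subSS subn0.
by rewrite big1 ?addr0 // => i _; rewrite mul0r.
Qed.

Lemma fpscoefXnM f k n :
  fpscoef (fpsX ^+ k * f) n = if (n < k)%N then 0 else fpscoef f (n - k)%N.
Proof.
elim: k n => [|k IHk] n; first by rewrite mul1r subn0.
by rewrite exprS -mulrA fpscoefXM; case: n => [|n] //; rewrite IHk ltnS subSS.
Qed.

(* Convergence of the series with terms [u i] to [g] in the topology of
   coefficientwise stabilization. *)
Definition fps_sums_to (u : nat -> fps R) g :=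
  forall m, exists N, forall K, (N <= K)%N ->
    fpscoef (\sum_(i < K) u i) m = fpscoef g m.

(* The sum of the series, 0 if it does not converge. *)
Definition fps_series (u : nat -> fps R) : fps R :=
  xget 0 [set g | fps_sums_to u g]%classic.

Lemma fps_sums_to_unique u g h : fps_sums_to u g -> fps_sums_to u h -> g = h.
Proof.
move=> ug uh; apply: fpsP => m; have [N gN] := ug m; have [N' hN'] := uh m.
by rewrite -(gN (maxn N N')) ?leq_maxl // hN' ?leq_maxr.
Qed.

Lemma fps_series_sums_to u :
  (forall m n, (m < n)%N -> fpscoef (u n) m = 0) ->
  fps_sums_to u (fps_series u).
Proof.
move=> u0; apply: (@xgetPex _ 0 [set g | fps_sums_to u g]%classic).
exists (Fps (fun m => fpscoef (\sum_(i < m.+1) u i) m)) => m.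
exists m.+1 => K leK /=.
rewrite !fpscoef_sum -(subnKC leK) big_split_ord /= [X in _ + X]big1 ?addr0 //.
by move=> i _; rewrite u0 // leq_addr.
Qed.

End FpsRing.

Section FpsUnit.
Variable R : comUnitRingType.
Implicit Types f g : fps R.

(* [fps_inv_seq f n] lists the coefficients of degree at most n of 1/f. *)
Fixpoint fps_inv_seq f n : seq R :=
  if n is m.+1 then
    let s := fps_inv_seq f m in
    rcons s (- (fpscoef f 0)^-1 * \sum_(i < n) fpscoef f i.+1 * s`_(m - i))
  else [:: (fpscoef f 0)^-1].

Definition fps_unit : {pred fps R} := [pred f | fpscoef f 0 \is a GRing.unit].

Definition fps_inv f : fps R :=
  if fpscoef f 0 \is a GRing.unit then Fps (fun n => (fps_inv_seq f n)`_n) else f.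

Let size_inv_seq f n : size (fps_inv_seq f n) = n.+1.
Proof. by elim: n => //= n IHn; rewrite size_rcons IHn. Qed.

Let nth_inv_seq f n i : (i <= n)%N ->
  (fps_inv_seq f n)`_i = (fps_inv_seq f i)`_i.
Proof.
elim: n => [|n IHn]; first by rewrite leqn0 => /eqP ->.
rewrite leq_eqVlt => /predU1P[-> //|ltin].
by rewrite [fps_inv_seq f n.+1]/= nth_rcons size_inv_seq ltin IHn.
Qed.

Fact fps_mulVx : {in fps_unit, left_inverse 1 fps_inv *%R}.
Proof.
move=> f; rewrite unfold_in /= => Uf; rewrite mulrC /fps_inv Uf.
apply: fpsP => n; rewrite fpscoefM fpscoef1.
rewrite big_ord_recl /= subn0; case: n => [|n].
  by rewrite big_ord0 addr0 /= divrr.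
rewrite /= nth_rcons size_inv_seq ltnn eqxx mulrA mulrN divrr // mulN1r.
rewrite addrC; apply/eqP; rewrite subr_eq0; apply/eqP; apply: eq_bigr => i _.
by rewrite /bump add1n subSS [in RHS]nth_inv_seq ?leq_subr.
Qed.

Fact fps_unitPl f g : g * f = 1 -> fps_unit f.
Proof.
move=> /(congr1 (fun h => fpscoef h 0%N)).
rewrite fpscoefM big_ord1 fpscoef1 => gf1.
by apply/unitrP; exists (fpscoef g 0); split; rewrite -[RHS]gf1 1?mulrC.
Qed.

Fact fps_inv_out : {in [predC fps_unit], fps_inv =1 id}.
Proof.
by move=> f; rewrite !inE /= /fps_inv => /negPf ->.
Qed.

HB.instance Definition _ := GRing.ComNzRing_hasMulInverse.Build (fps R)
  fps_mulVx fps_unitPl fps_inv_out.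

Lemma fps_unitE f : (f \is a GRing.unit) = (fpscoef f 0 \is a GRing.unit).
Proof. by []. Qed.

End FpsUnit.

Definition qpoch (A : comNzRingType) (a q : A) (n : nat) : A :=
  \prod_(k < n) (1 - a * q ^+ k).

Definition rho6_term (n : nat) : fps int :=
  let q := fpsX int in
  q ^+ (n * n.+1 %/ 2) * qpoch (- q) q n / qpoch q (q ^+ 2) n.+1.

Definition rho6 : fps int := fps_series rho6_term.

Lemma rho6_den_unit n :
  qpoch (fpsX int) (fpsX int ^+ 2) n.+1 \is a GRing.unit.
Proof.
apply: rpred_prod => i _.
by rewrite fps_unitE fpscoefD fpscoefN fpscoefXM subr0.
Qed.

Lemma rho6_sums_to : fps_sums_to rho6_term rho6.
Proof.
apply: fps_series_sums_to => m n ltmn.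
rewrite /rho6_term -mulrA fpscoefXnM (leq_trans ltmn) //.
case: n {ltmn} => // n; rewrite leq_divRL // leq_mul2l.
by [].
Qed.

(* Main.v *)
Require Import Defs.
From mathcomp Require Import all_boot all_order all_algebra.
From mathcomp Require Import reals.
From mathcomp Require Import zify ring lra.

Set Implicit Arguments.
Unset Strict Implicit.
Unset Printing Implicit Defensive.

Import Order.TTheory GRing.Theory Num.Theory.

Local Open Scope ring_scope.

(** Signs do not matter modulo 2, so the coefficients of rho may be replaced by
    those of the alternating series, which has a sparse closed form:
      sum_n (-1)^n q^(n(n+1)/2) (-q;q)_n / (q;q^2)_(n+1)
        = sum_j (-1)^j q^(j(j+1)).
    The right-hand side has coefficients +1 or -1 at the exponents j(j+1), which
    are pairwise distinct, and 0 elsewhere; this is the parity statement.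

    To prove the identity, insert a parameter y and let S(y) be the sum of
      t(y, n) = (-1)^n y^n q^(n(n+1)/2) (-q;q)_n / (qy;q^2)_(n+1).
    With T(n) = (1 - y q^(n+1)) t(y, n) the combination
    t(y, n) + q^2 y t(q^2 y, n) equals T(n) - T(n+1) ([alt_term_telescope]).
    Since T(0) = 1 and T(n) tends to 0, S(y) = 1 - q^2 y S(q^2 y); iterating from
    y = 1 through y = q^2, q^4, ... produces the sum over j.  All of this is done
    with partial sums of length N and an error divisible by q^N
    ([sum_alt_term_iter]), which determines the coefficients below N.

    For the count, the m+1 pronic numbers up to N are those k(k+1) with k <= m,
    where m(m+1) <= N < (m+1)(m+2); multiplying by 4 and adding 1 turns these
    bounds into (2m+1)^2 <= 4N+1 < (2m+3)^2, which says that m+1 is the floor of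
    (sqrt(4N+1)+1)/2. *)

Lemma triangular_succ n : (n.+1 * n.+2 %/ 2 = n * n.+1 %/ 2 + n.+1)%N.
Proof.
have -> : (n.+1 * n.+2 = n.+1 * 2 + n * n.+1)%N by lia.
by rewrite divnMDl // addnC.
Qed.

Section Telescoping.
Variables (A : comUnitRingType) (q : A).

Lemma qpoch_recl (a p : A) n :
  qpoch a p n.+1 = (1 - a) * qpoch (a * p) p n.
Proof.
rewrite /qpoch big_ord_recl expr0 mulr1; congr (_ * _).
by apply: eq_bigr => i _; rewrite lift0 exprS mulrA.
Qed.

Lemma qpoch_recr (a p : A) n :
  qpoch a p n.+1 = qpoch a p n * (1 - a * p ^+ n).
Proof. by rewrite /qpoch big_ord_recr. Qed.

(** The parameter [y] is what makes the series satisfy a first-order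
    [q]-difference equation; the case [y = 1] is, up to the sign [(-1) ^+ n],
    the series defining rho. *)
Definition alt_term (y : A) n : A :=
  (-1) ^+ n * y ^+ n * (q ^+ (n * n.+1 %/ 2) * qpoch (- q) q n)
  / qpoch (q * y) (q ^+ 2) n.+1.

(** The denominators (qy;q^2)_(n+1) and (q^3 y;q^2)_(n+1) are (qy;q^2)_(n+2)
    without its last, respectively first, factor.  Over this common denominator
    the claim is a polynomial identity in q, y and q^n. *)
Lemma alt_term_telescope y n :
  qpoch (q * y) (q ^+ 2) n.+2 \is a GRing.unit ->
  alt_term y n + q ^+ 2 * y * alt_term (q ^+ 2 * y) n
  = (1 - y * q ^+ n.+1) * alt_term y n
    - (1 - y * q ^+ n.+2) * alt_term y n.+1.
Proof.
rewrite /alt_term triangular_succ [qpoch (- q) q n.+1]qpoch_recr.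
move: (qpoch_recr (q * y) (q ^+ 2) n.+1) (qpoch_recl (q * y) (q ^+ 2) n.+1).
have -> : q * y * q ^+ 2 = q * (q ^+ 2 * y) by ring.
set D := qpoch _ _ n.+2; set D1 := qpoch _ _ n.+1; set D2 := qpoch _ _ n.+1.
move=> defD1 defD2 uD.
have [uD1 uE1] : D1 \is a GRing.unit
    /\ 1 - q * y * (q ^+ 2) ^+ n.+1 \is a GRing.unit.
  by apply/andP; rewrite -unitrM -defD1.
have [uE2 uD2] : 1 - q * y \is a GRing.unit /\ D2 \is a GRing.unit.
  by apply/andP; rewrite -unitrM -defD2.
have -> : D1^-1 = (1 - q * y * (q ^+ 2) ^+ n.+1) / D.
  by rewrite defD1 invrM // mulrA divrr // mul1r.
have -> : D2^-1 = (1 - q * y) / D.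
  by rewrite defD2 invrM // mulrCA divrr // mulr1.
have -> : (q ^+ 2) ^+ n.+1 = q ^+ 2 * (q ^+ n) ^+ 2 by rewrite exprS exprAC.
rewrite exprMn exprD [(q ^+ 2) ^+ n]exprAC ![_ ^+ n.+2]exprS ![_ ^+ n.+1]exprS.
move: (q ^+ n) (y ^+ n) ((-1) ^+ n) (q ^+ _) (qpoch _ _ _) => Q Y s t p.
ring.
Qed.

(** Partial sums of the telescoping identity: S(y) + q^2 y S(q^2 y) = 1, up to
    the boundary term at [N]. *)
Lemma sum_alt_term_rec y N :
  (forall n, qpoch (q * y) (q ^+ 2) n \is a GRing.unit) ->
  \sum_(n < N) alt_term y n + q ^+ 2 * y * \sum_(n < N) alt_term (q ^+ 2 * y) n
  = 1 - (1 - y * q ^+ N.+1) * alt_term y N.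
Proof.
move=> uD; elim: N => [|N IHN].
  rewrite !big_ord0 mulr0 addr0 /alt_term /= !expr0 !mul1r.
  have := uD 1%N; rewrite /qpoch big_ord0 big_ord1 expr0 !mulr1 => u1.
  by rewrite [y * q]mulrC div1r divrr // subrr.
rewrite !big_ord_recr /= mulrDr addrACA IHN alt_term_telescope //.
by ring.
Qed.

Lemma alt_term_dvd y n : exists h, alt_term y n = q ^+ n * h.
Proof.
have le_tri : (n <= n * n.+1 %/ 2)%N.
  by case: n => // n; rewrite leq_divRL // leq_mul2l.
exists ((-1) ^+ n * y ^+ n * (q ^+ (n * n.+1 %/ 2 - n) * qpoch (- q) q n)
        / qpoch (q * y) (q ^+ 2) n.+1).
rewrite /alt_term -[in LHS](subnKC le_tri) exprD [RHS]mulrA; congr (_ / _).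
ring.
Qed.

(** Iterating S(y) = 1 - q^2 y S(q^2 y) from y = 1: the weights q^2 y met on the
    way are q^2, q^4, ..., q^(2J), with product q^(J(J+1)). *)
Lemma sum_alt_term_iter J N :
  (forall j n, qpoch (q * (q ^+ 2) ^+ j) (q ^+ 2) n \is a GRing.unit) ->
  exists h, \sum_(n < N) alt_term 1 n
    = \sum_(j < J) (-1) ^+ j * q ^+ (j * (j + 1))
      + (-1) ^+ J * q ^+ (J * (J + 1)) * \sum_(n < N) alt_term ((q ^+ 2) ^+ J) n
      + q ^+ N * h.
Proof.
move=> uD; elim: J => [|J [h ->]].
  by exists 0; rewrite big_ord0 !expr0; ring.
have [g defg] := alt_term_dvd ((q ^+ 2) ^+ J) N.
have := @sum_alt_term_rec _ N (uD J).
rewrite defg -exprS => /(canRL (addrK _)) ->.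
exists (h - (-1) ^+ J * q ^+ (J * (J + 1)) * (1 - (q ^+ 2) ^+ J * q ^+ N.+1) * g).
rewrite big_ord_recr /= [(-1) ^+ J.+1]exprS.
have -> : q ^+ (J.+1 * (J.+1 + 1)) = q ^+ (J * (J + 1)) * (q ^+ 2) ^+ J.+1.
  by rewrite -exprM -exprD; congr (_ ^+ _); lia.
ring.
Qed.

End Telescoping.

Lemma rho6_term_alt n : rho6_term n = (-1) ^+ n * alt_term (fpsX int) 1 n.
Proof.
rewrite /rho6_term /alt_term expr1n !mulr1 !mulrA -exprMn mulrNN mulr1 expr1n.
by rewrite mul1r.
Qed.

Lemma fpscoefXn (R : comNzRingType) k n :
  fpscoef (fpsX R ^+ k) n = (n == k)%:R.
Proof.
rewrite -[_ ^+ k]mulr1 fpscoefXnM fpscoef1 subn_eq0 ltnNge.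
by rewrite eqn_leq; case: (k <= n)%N; rewrite ?andbT ?andbF.
Qed.

Lemma odd_abszD (x y : int) : odd `|(x + y)%R|%N = odd `|x|%N (+) odd `|y|%N.
Proof. lia. Qed.

Lemma odd_absz_sum I (r : seq I) (F : I -> int) :
  odd `|(\sum_(i <- r) F i)%R|%N = \big[addb/false]_(i <- r) odd `|F i|%N.
Proof. by apply: (big_morph (fun x : int => odd `|x|%N) odd_abszD). Qed.

Lemma fpscoef_signM n (f : fps int) m :
  fpscoef ((-1) ^+ n * f) m = (-1) ^+ n * fpscoef f m.
Proof.
elim: n => [|n IHn]; first by rewrite !expr0 !mul1r.
by rewrite !exprS -!mulrA !mulN1r fpscoefN IHn.
Qed.

Lemma rho6_den_shift_unit j n :
  qpoch (fpsX int * (fpsX int ^+ 2) ^+ j) (fpsX int ^+ 2) n \is a GRing.unit.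
Proof.
apply: rpred_prod => i _.
by rewrite fps_unitE fpscoefD fpscoefN -mulrA fpscoefXM subr0.
Qed.

(** Taking as many iterations as summands, N > n of each, puts both the remaining
    sum, of order at least N(N+1), and the error, of order at least N, beyond
    degree n. *)
Lemma odd_rho6 n :
  odd `|fpscoef rho6 n|%N <-> exists k : nat, n = (k * (k + 1))%N.
Proof.
have [N0 rhoN] := rho6_sums_to n.
pose N := maxn N0 n.+1.
have ltnN : (n < N)%N by rewrite leq_maxr.
have [h eqh] := @sum_alt_term_iter _ (fpsX int) N N rho6_den_shift_unit.
have -> : odd `|fpscoef rho6 n|%N
    = odd `|fpscoef (\sum_(i < N) alt_term (fpsX int) 1 i)%R n|%N.
  rewrite -(rhoN N (leq_maxl _ _)) 2!fpscoef_sum 2!odd_absz_sum.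
  apply: eq_bigr => i _.
  rewrite rho6_term_alt fpscoef_signM.
  by rewrite abszMsign.
have -> : fpscoef (\sum_(i < N) alt_term (fpsX int) 1 i) n
   = \sum_(j < N) (-1) ^+ j * (n == j * (j + 1))%N%:R.
  have leN : (n < N * (N + 1))%N by nia.
  rewrite eqh !fpscoefD -mulrA fpscoef_signM !fpscoefXnM ltnN leN mulr0 !addr0.
  by rewrite fpscoef_sum; apply: eq_bigr => j _; rewrite fpscoef_signM fpscoefXn.
rewrite odd_absz_sum; split=> [|[k defn]].
  move=> oddn; case: (boolP [exists j : 'I_N, n == j * (j + 1)]%N).
    by case/existsP=> j /eqP ->; exists j.
  rewrite negb_exists => /forallP noj; move: oddn.
  by rewrite big1 // => j _; rewrite (negPf (noj j)) mulr0.
have ltkN : (k < N)%N by nia.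
rewrite (bigD1 (Ordinal ltkN)) //= abszMsign defn eqxx big1 //= => j.
rewrite -val_eqE /= => nejk; case: eqP => [|_]; last by rewrite mulr0.
by move: nejk => /[swap]; nia.
Qed.

Lemma card_pronic N m : (m * m.+1 <= N < m.+1 * m.+2)%N ->
  #|[set n : 'I_N.+1 | [exists k : 'I_m.+1, n == k * (k + 1) :> nat]%N]| = m.+1.
Proof.
case/andP=> lemN ltNm.
have ltN (k : 'I_m.+1) : (k * (k + 1) < N.+1)%N by have := ltn_ord k; nia.
rewrite -[RHS]card_ord -(card_imset _ (f := fun k => Ordinal (ltN k))).
  apply: eq_card => n; rewrite inE; apply/existsP/imsetP => [[k /eqP nk]|[k _ ->]].
    by exists k => //; apply: val_inj.
  by exists k.
by move=> j k /(congr1 val) /= eqjk; apply: val_inj => /=; nia.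
Qed.

Theorem theorem6p3 :
  (forall n : nat,
     odd `|fpscoef rho6 n|%N <-> exists k : nat, n = (k * (k + 1))%N)
  /\
  (forall (R : realType) (N : nat),
     #|[set n : 'I_N.+1 | (fpscoef rho6 n == 1 %[mod 2])%Z]|%:Z
     = Num.floor ((Num.sqrt (4 * N%:R + 1) + 1) / 2 : R)).
Proof.
split=> [|R N]; first exact: odd_rho6.
have [m /andP[lemN ltNm]] : exists m, (m * m.+1 <= N < m.+1 * m.+2)%N.
  have exm : exists m, (N < m.+1 * m.+2)%N by exists N; nia.
  case: (ex_minnP exm) => -[|m] ltN minm; first by exists 0%N.
  by exists m.+1; rewrite ltN leqNgt andbT; apply/negP => /minm; rewrite ltnn.
have -> : [set n : 'I_N.+1 | (fpscoef rho6 n == 1 %[mod 2])%Z]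
    = [set n : 'I_N.+1 | [exists k : 'I_m.+1, n == k * (k + 1) :> nat]%N].
  apply/setP => n; rewrite !inE.
  have -> : (fpscoef rho6 n == 1 %[mod 2])%Z = odd `|fpscoef rho6 n|%N by lia.
  apply/idP/existsP => [/odd_rho6[k nk]|[k /eqP nk]].
    have ltkm : (k < m.+1)%N by have := ltn_ord n; nia.
    by exists (Ordinal ltkm); apply/eqP.
  by apply/odd_rho6; exists k.
rewrite card_pronic ?lemN //; apply/esym/floor_def.
have lemR : m%:R * (m%:R + 1) <= N%:R :> R by rewrite natr1 -natrM ler_nat.
have ltmR : N%:R < (m%:R + 1) * (m%:R + 2) :> R.
  by rewrite natr1 -natrD -natrM ltr_nat addn2.
have s_ge0 := sqrtr_ge0 (4 * N%:R + 1 : R).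
have := @sqr_sqrtr R (4 * N%:R + 1); rewrite addr_ge0 ?mulr_ge0 // => /(_ isT).
move: (Num.sqrt _) s_ge0 => s s_ge0 sq_s.
have m_ge0 : 0 <= m%:R :> R by [].
rewrite intrD -[m.+1%:~R]/(m.+1%:R) -natr1 ler_pdivlMr // ltr_pdivrMr //.
by apply/andP; split; nra.
Qed.
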